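(* Let $A,B\in\mathbb{R}^{n\times n}$ with $A-B$ nonsingular, let $c\in\mathbb{R}^n$, and suppose $Q:=(A^{\mathsf T}+B^{\mathsf T})(A^{\mathsf T}-B^{\mathsf T})^{-1}$ is nondegenerate. Let $\{w^k\}_{k=0}^\infty\subseteq\mathbb{R}^n\times\mathbb{R}^n$ be any sequence satisfying $w^{k+1}\in(P_{C_1}\circ P_{C_2})(w^k)$ for all $k\ge0$, and suppose there exists a function $\tau:\{1,\dots,n\}\to\{1,2\}$ such that $S_\tau\cap(C_1\cap C_2)=\emptyset$. Then there does not exist $N\in\mathbb{N}$ such that $\{w^k\}_{k=N}^\infty\subseteq S_\tau\cap\Omega$, where $\Omega:=\{w=(u,v)\in\mathbb{R}^n\times\mathbb{R}^n:(u_i,v_i)\notin\mathbb{R}^2_{--}\ \forall i=1,\dots,n\}$.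
   Context: A square matrix is nondegenerate if all its principal minors are nonzero. $\mathbb{R}^2_{--}=\{(a,b)\in\mathbb{R}^2:a<0,\ b<0\}$. $K_1:=\{(a,b)\in\mathbb{R}^2:a>b\text{ or }a=b\le0\}$ and $K_2:=\{(a,b)\in\mathbb{R}^2:a<b\text{ or }a=b\le0\}$. For $\tau:\{1,\dots,n\}\to\{1,2\}$, $S_\tau$ is the set of all $w=(u,v)\in\mathbb{R}^n\times\mathbb{R}^n$ with $(u_i,v_i)\in K_{\tau(i)}$ for each $i=1,\dots,n$. With $T=[\,A+B\;\;\;-A+B\,]\in\mathbb{R}^{n\times 2n}$, $C_1:=\{w\in\mathbb{R}^n\times\mathbb{R}^n: Tw=\sqrt2\,c\}$ and $C_2:=\{w=(u,v)\in\mathbb{R}^n\times\mathbb{R}^n: u\ge 0,\ v\ge 0,\ \langle u,v\rangle=0\}$ (inequalities componentwise). For a set $S$, $P_S(z):=\{s\in S:\|s-z\|\le\|t-z\|\ \forall t\in S\}$ is the (possibly multivalued) Euclidean metric projector, and $(P_{C_1}\circ P_{C_2})(w)=\bigcup_{w'\in P_{C_2}(w)}P_{C_1}(w')$. *)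

(* Defs.v *)
From mathcomp Require Import all_boot all_order all_algebra.
From mathcomp Require Import all_classical all_reals.

Set Implicit Arguments.
Unset Strict Implicit.
Unset Printing Implicit Defensive.

Import Order.TTheory GRing.Theory Num.Theory.

Local Open Scope classical_set_scope.
Local Open Scope ring_scope.

(* The principal submatrices are indexed by the subsets J of the index set;
   the empty one has determinant 1 and adds no condition. *)
Definition nondegenerate_mx (R : realType) (n : nat) (M : 'M[R]_n) : Prop :=
  forall J : {set 'I_n},
    \det (mxsub (@enum_val _ (mem J)) (@enum_val _ (mem J)) M) != 0.

Definition dot (R : realType) (n : nat) (x y : 'cV[R]_n) : R :=
  \sum_(i < n) x i 0 * y i 0.

(* The norm that MathComp-Analysis puts on matrices and on pairs is the
   maximum norm, hence this separate definition. *)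
Definition enorm (R : realType) (n : nat) (w : 'cV[R]_n * 'cV[R]_n) : R :=
  Num.sqrt (dot w.1 w.1 + dot w.2 w.2).

Definition metric_proj (R : realType) (n : nat) (S : set ('cV[R]_n * 'cV[R]_n))
    (z : 'cV[R]_n * 'cV[R]_n) : set ('cV[R]_n * 'cV[R]_n) :=
  [set s | S s /\ forall t, S t -> enorm (s - z) <= enorm (t - z)].

Definition Tmx (R : realType) (n : nat) (A B : 'M[R]_n) : 'M[R]_(n, n + n) :=
  row_mx (A + B) (- A + B).

Definition C1 (R : realType) (n : nat) (A B : 'M[R]_n) (c : 'cV[R]_n) :
    set ('cV[R]_n * 'cV[R]_n) :=
  [set w : 'cV[R]_n * 'cV[R]_n | Tmx A B *m col_mx w.1 w.2 = Num.sqrt 2 *: c].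

Definition C2 (R : realType) (n : nat) : set ('cV[R]_n * 'cV[R]_n) :=
  [set w : 'cV[R]_n * 'cV[R]_n |
    [/\ forall i, 0 <= w.1 i 0, forall i, 0 <= w.2 i 0 & dot w.1 w.2 = 0]].

Definition projC1C2 (R : realType) (n : nat) (A B : 'M[R]_n) (c : 'cV[R]_n)
    (w : 'cV[R]_n * 'cV[R]_n) : set ('cV[R]_n * 'cV[R]_n) :=
  \bigcup_(w' in metric_proj (@C2 R n) w) metric_proj (C1 A B c) w'.

Definition K1 (R : realType) : set (R * R) :=
  [set p : R * R | p.1 > p.2 \/ (p.1 = p.2 /\ p.2 <= 0)].

Definition K2 (R : realType) : set (R * R) :=
  [set p : R * R | p.1 < p.2 \/ (p.1 = p.2 /\ p.2 <= 0)].

Definition negquadrant (R : realType) : set (R * R) :=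
  [set p : R * R | p.1 < 0 /\ p.2 < 0].

(* The element 0 of 'I_2 stands for the index 1, and the element 1 for the
   index 2. *)
Definition Ktau (R : realType) (j : 'I_2) : set (R * R) :=
  if j == 0 then @K1 R else @K2 R.

Definition Stau (R : realType) (n : nat) (tau : 'I_n -> 'I_2) :
    set ('cV[R]_n * 'cV[R]_n) :=
  [set w : 'cV[R]_n * 'cV[R]_n | forall i, @Ktau R (tau i) (w.1 i 0, w.2 i 0)].

Definition Omega (R : realType) (n : nat) : set ('cV[R]_n * 'cV[R]_n) :=
  [set w : 'cV[R]_n * 'cV[R]_n | forall i, ~ @negquadrant R (w.1 i 0, w.2 i 0)].

(* Main.v *)
Require Import Defs.
From mathcomp Require Import all_boot all_order all_algebra.
From mathcomp Require Import all_classical all_reals.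
From mathcomp Require Import ring lra.

Set Implicit Arguments.
Unset Strict Implicit.
Unset Printing Implicit Defensive.

Import Order.TTheory GRing.Theory Num.Theory.

Local Open Scope classical_set_scope.
Local Open Scope ring_scope.

(** Write J for the set of indices i with tau i = 1, and L for the coordinate
    subspace of pairs (u, v) with v = 0 on J and u = 0 off J.  On
    S_tau intersected with Omega the projection onto C2 is single-valued: it is
    the orthogonal projection onto L, and its values have nonnegative entries
    ([metric_proj_C2]).  A sequence that stays there therefore performs
    alternating projections between the affine space C1 and the subspace L.

    Nondegeneracy of Q says that T restricted to L is invertible
    ([basis_mx_unit]), so C1 and L meet in exactly one point.  Let x* be its
    coordinate vector in L, x_k that of the projection of w^k onto L, and
    a_k = |x_k - x*|^2.  Pythagoras' theorem for the projection onto C1,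
    together with the injectivity of T on L, gives a constant K such that
    a_k <= K (a_k - a_(k+1)) ([alternating_step]); in particular the a_k decrease
    to 0.  If x* had a negative entry, then x_k >= 0 would keep a_k above the
    square of this entry, so that a_k would decrease by at least a fixed positive
    amount at each step, which is impossible for nonnegative numbers.  Hence
    x* >= 0, and the common point of C1 and L lies in C2 and in S_tau, against
    the assumption that S_tau misses the intersection of C1 and C2. *)

(** * The Euclidean inner product *)

Section InnerProduct.
Context {R : realType}.

Lemma dotC n (x y : 'cV[R]_n) : dot x y = dot y x.
Proof. by apply: eq_bigr => i _; rewrite mulrC. Qed.

Lemma dotDl n (x y z : 'cV[R]_n) : dot (x + y) z = dot x z + dot y z.
Proof. by rewrite -big_split; apply: eq_bigr => i _; rewrite mxE mulrDl. Qed.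

Lemma dotZl n s (x z : 'cV[R]_n) : dot (s *: x) z = s * dot x z.
Proof. by rewrite mulr_sumr; apply: eq_bigr => i _; rewrite mxE mulrA. Qed.

Lemma dotDr n (x y z : 'cV[R]_n) : dot z (x + y) = dot z x + dot z y.
Proof. by rewrite dotC dotDl !(dotC z). Qed.

Lemma dotZr n s (x z : 'cV[R]_n) : dot z (s *: x) = s * dot z x.
Proof. by rewrite dotC dotZl (dotC z). Qed.

Lemma dot_ge0 n (x : 'cV[R]_n) : 0 <= dot x x.
Proof. by apply: sumr_ge0 => i _; rewrite -expr2 sqr_ge0. Qed.

Lemma sqr_coord_le_dot n (x : 'cV[R]_n) i : x i 0 ^+ 2 <= dot x x.
Proof.
rewrite /dot (bigD1 i) //= -expr2 lerDl.
by apply: sumr_ge0 => j _; rewrite -expr2 sqr_ge0.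
Qed.

Lemma dot_cauchy_schwarz n (x y : 'cV[R]_n) :
  dot x y ^+ 2 <= dot x x * dot y y.
Proof.
have := dot_ge0 y; rewrite le_eqVlt => /predU1P[y0|y_gt0].
  have yz : y = 0.
    apply/colP => i; rewrite mxE; apply/eqP; rewrite -sqrf_eq0 eq_le sqr_ge0.
    by rewrite andbT y0 sqr_coord_le_dot.
  have -> : dot x y = 0 by apply: big1 => i _; rewrite yz mxE mulr0.
  by rewrite -y0 expr0n mulr0.
have := dot_ge0 (dot y y *: x + (- dot x y) *: y).
rewrite !(dotDl, dotDr, dotZl, dotZr) (dotC y x).
set a := dot x x; set b := dot x y; set d := dot y y => h.
suff : 0 <= d * (a * d - b ^+ 2) by rewrite pmulr_rge0 // subr_ge0.
by move: h; congr (_ <= _); ring.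
Qed.

(** The constant is the squared Frobenius norm of [M]. *)
Lemma mulmx_dot_bound m n (M : 'M[R]_(m, n)) :
  exists2 K, 0 <= K & forall z, dot (M *m z) (M *m z) <= K * dot z z.
Proof.
exists (\sum_i dot (row i M)^T (row i M)^T) => [|z].
  by apply: sumr_ge0 => i _; apply: dot_ge0.
rewrite mulr_suml; apply: ler_sum => i _; rewrite -expr2.
have -> : (M *m z) i 0 = dot (row i M)^T z.
  by rewrite mxE; apply: eq_bigr => j _; rewrite !mxE.
exact: dot_cauchy_schwarz.
Qed.

Definition pair_dot n (w z : 'cV[R]_n * 'cV[R]_n) := dot w.1 z.1 + dot w.2 z.2.

Lemma pair_dot_ge0 n (w : 'cV[R]_n * 'cV[R]_n) : 0 <= pair_dot w w.
Proof. by rewrite addr_ge0 ?dot_ge0. Qed.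

Lemma ler_enorm n (w z : 'cV[R]_n * 'cV[R]_n) :
  (enorm w <= enorm z) = (pair_dot w w <= pair_dot z z).
Proof. by rewrite ler_sqrt // pair_dot_ge0. Qed.

Lemma dot_col_mx m n (u x : 'cV[R]_m) (v y : 'cV[R]_n) :
  dot (col_mx u v) (col_mx x y) = dot u x + dot v y.
Proof.
by rewrite /dot big_split_ord /=; congr (_ + _); apply: eq_bigr => i _;
  rewrite ?col_mxEu ?col_mxEd.
Qed.

End InnerProduct.

(** * Projection onto the affine space C1 *)

Lemma linear_coef_eq0 (R : realType) (a b : R) :
  0 <= a -> (forall s, 0 <= 2 * s * b + s ^+ 2 * a) -> b = 0.
Proof.
move=> a_ge0 h; have a1 : 0 < a + 1 by lra.
(* At this s the expression is - b ^+ 2 * (a + 2) / (a + 1) ^+ 2. *)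
have := h (- b / (a + 1)).
have -> : 2 * (- b / (a + 1)) * b + (- b / (a + 1)) ^+ 2 * a
        = - ((a + 2) * (b / (a + 1)) ^+ 2) by field; lra.
rewrite oppr_ge0 pmulr_rle0; last by lra.
move=> q; have /eqP : (b / (a + 1)) ^+ 2 == 0 by rewrite eq_le q sqr_ge0.
by move/eqP; rewrite sqrf_eq0 mulf_eq0 invr_eq0 (gt_eqF a1) orbF => /eqP.
Qed.

Lemma metric_proj_C1_pythagoras (R : realType) n (A B : 'M[R]_n) c y p t :
  metric_proj (C1 A B c) y p -> C1 A B c t ->
  pair_dot (y - t) (y - t) =
    pair_dot (p - t) (p - t) + pair_dot (y - p) (y - p).
Proof.
move=> [Cp pmin] Ct.
have orth : pair_dot (t - p) (p - y) = 0.
  apply: (@linear_coef_eq0 _ (pair_dot (t - p) (t - p))) => [|s].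
    exact: pair_dot_ge0.
  have Cs : C1 A B c (p + s *: (t - p)).
    move: Cp Ct; rewrite /C1 /= => Cp Ct.
    have -> : col_mx (p.1 + s *: (t.1 - p.1)) (p.2 + s *: (t.2 - p.2))
            = col_mx p.1 p.2 + s *: (col_mx t.1 t.2 - col_mx p.1 p.2).
      by rewrite opp_col_mx add_col_mx scale_col_mx add_col_mx.
    by rewrite mulmxDr -scalemxAr mulmxBr Cp Ct subrr scaler0 addr0.
  have := pmin _ Cs; rewrite ler_enorm -subr_ge0; congr (_ <= _).
  have -> : p + s *: (t - p) - y = (p - y) + s *: (t - p) by rewrite addrAC.
  rewrite /pair_dot /= !(dotDl (p.1 - y.1), dotDl (p.2 - y.2)).
  rewrite !(dotDr (p.1 - y.1), dotDr (p.2 - y.2)) !dotZl !dotZr.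
  rewrite (dotC (p.1 - y.1) (t.1 - p.1)) (dotC (p.2 - y.2) (t.2 - p.2)).
  ring.
have -> : y - t = (-1) *: ((t - p) + (p - y)).
  by rewrite addrA subrK scaleN1r opprB.
have -> : p - t = (-1) *: (t - p) by rewrite scaleN1r opprB.
have -> : y - p = (-1) *: (p - y) by rewrite scaleN1r opprB.
move: (t - p) (p - y) orth => d e; rewrite /pair_dot /= => orth.
rewrite !(dotZl, dotZr, dotDl, dotDr) (dotC e.1) (dotC e.2).
by rewrite -[RHS]addr0 -[X in _ = _ + X](mulr0 2) -orth; ring.
Qed.

(** * The coordinate subspaces contained in complementary pairs *)

Section CoordinateSubspace.
Context {R : realType} {n : nat}.
Implicit Types (J : {set 'I_n}) (x : 'cV[R]_n) (w : 'cV[R]_n * 'cV[R]_n).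

(** Isometric parametrization of the subspace of pairs (u, v) with v = 0 on J
    and u = 0 off J. *)
Definition embed J x : 'cV[R]_n * 'cV[R]_n :=
  (\col_i (if i \in J then x i 0 else 0), \col_i (if i \in J then 0 else x i 0)).

(** The adjoint of [embed]; [embed J (coords J w)] is the orthogonal projection
    of [w] onto the subspace. *)
Definition coords J w : 'cV[R]_n :=
  \col_i (if i \in J then w.1 i 0 else w.2 i 0).

(** The matrix of T restricted to the subspace, in the coordinates given by
    [embed]. *)
Definition basis_mx (A B : 'M[R]_n) J : 'M[R]_n :=
  \matrix_(i, j) (if j \in J then (A + B) i j else (- A + B) i j).

Lemma mul_basis_mx A B J x :
  basis_mx A B J *m x = Tmx A B *m col_mx (embed J x).1 (embed J x).2.
Proof.
rewrite mul_row_col; apply/colP => i; rewrite !mxE -big_split /=.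
apply: eq_bigr => j _; rewrite !mxE.
by case: ifP => _; rewrite mulr0 ?addr0 ?add0r.
Qed.

Lemma embedB J x y : embed J (x - y) = embed J x - embed J y.
Proof.
by apply: injective_projections; apply/colP => i; rewrite !mxE; case: ifP;
  rewrite ?subr0.
Qed.

Lemma dot_embed J x : pair_dot (embed J x) (embed J x) = dot x x.
Proof.
rewrite /pair_dot -big_split /=; apply: eq_bigr => i _; rewrite !mxE.
by case: ifP; rewrite mulr0 ?addr0 ?add0r.
Qed.

Lemma dot_coords_le J w : dot (coords J w) (coords J w) <= pair_dot w w.
Proof.
rewrite /pair_dot -big_split /=; apply: ler_sum => i _; rewrite !mxE.
by case: ifP => _; rewrite -!expr2 ?lerDl ?lerDr sqr_ge0.
Qed.

Lemma coords_embedB J w x : coords J (w - embed J x) = coords J w - x.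
Proof. by apply/colP => i; rewrite !mxE; case: ifP => ->. Qed.

(** Read at the indices in [J], the equation is a homogeneous square system for
    the entries of [v] in [J], whose determinant is the principal minor of [Q]
    indexed by [J].  Once these entries vanish, the equation read off [J] gives
    the remaining ones. *)
Lemma nondegenerate_inj (Q : 'M[R]_n) J (v : 'rV[R]_n) :
  nondegenerate_mx Q ->
  (\row_i (if i \in J then v 0 i else 0)) *m Q
    = \row_i (if i \in J then 0 else v 0 i) ->
  v = 0.
Proof.
move=> /(_ J) detJ vQ.
pose vJ : 'rV[R]_#|mem J| := \row_k v 0 (enum_val k).
have vJ0 : vJ = 0.
  apply/eqP; apply: contraNT detJ => vJ_neq0; apply/det0P; exists vJ => //.
  apply/rowP => k; have /rowP/(_ (enum_val k)) := vQ.
  rewrite !mxE (enum_valP k) => vQk; rewrite -[RHS]vQk.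
  rewrite (bigID (mem J)) /= [X in _ = _ + X]big1 ?addr0; last first.
    by move=> i /negPf iJ; rewrite mxE iJ mul0r.
  rewrite [RHS]big_enum_val; apply: eq_bigr => l _.
  by rewrite !mxE (enum_valP l).
have vinJ i : i \in J -> v 0 i = 0.
  move=> iJ; have /rowP/(_ (enum_rank_in iJ i)) := vJ0.
  by rewrite !mxE enum_rankK_in.
apply/rowP => i; rewrite mxE; have [/vinJ //|iJ] := boolP (i \in J).
have /rowP/(_ i) := vQ; rewrite [in RHS]mxE (negPf iJ) => <-.
by rewrite mxE big1 // => j _; rewrite mxE; case: ifP => [/vinJ->|_];
  rewrite mul0r.
Qed.

(** Transposing and multiplying by the inverse of the transpose of A - B turns
    the columns of [basis_mx] into rows of Q and of the negated identity. *)
Lemma basis_mx_unit (A B : 'M[R]_n) J :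
  A - B \in unitmx ->
  nondegenerate_mx ((A^T + B^T) *m invmx (A^T - B^T)) ->
  basis_mx A B J \in unitmx.
Proof.
move=> ABu ndQ; rewrite -unitmx_tr unitmxE unitfE.
apply/negP => /det0P[v /negP v_neq0 vG]; apply/v_neq0/eqP.
have ABtu : A^T - B^T \in unitmx by rewrite -linearB unitmx_tr.
apply: (nondegenerate_inj (J := J) ndQ).
rewrite mulmxA; apply: (canLR (mulmxK ABtu)); apply/eqP.
rewrite -subr_eq0 -vG; apply/eqP/rowP => j.
rewrite !mxE -sumrB; apply: eq_bigr => i _; rewrite !mxE.
by case: ifP => _; ring.
Qed.

(** One round of alternating projections between C1 and the subspace decreases
    the squared distance to their common point by a fixed proportion.  The
    decrease is at least the squared distance from the current point to C1, and
    T, being invertible on the subspace, bounds the distance to the common point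
    in terms of it. *)
Lemma alternating_step (A B : 'M[R]_n) c J xs :
  basis_mx A B J \in unitmx -> C1 A B c (embed J xs) ->
  exists2 K, 0 <= K & forall x p, metric_proj (C1 A B c) (embed J x) p ->
    dot (x - xs) (x - xs) <=
      K * (dot (x - xs) (x - xs) - dot (coords J p - xs) (coords J p - xs)).
Proof.
move=> Gu Cxs.
have [K K_ge0 HK] := mulmx_dot_bound (invmx (basis_mx A B J) *m Tmx A B).
exists K => // x p proj_p.
have Cp : C1 A B c p by case: proj_p.
have pyth := metric_proj_C1_pythagoras proj_p Cxs.
rewrite -embedB dot_embed in pyth.
have near_p := dot_coords_le J (p - embed J xs).
rewrite coords_embedB in near_p.
apply: (@le_trans _ _ (K * pair_dot (embed J x - p) (embed J x - p))); last first.
  by apply: ler_wpM2l => //; rewrite pyth; lra.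
rewrite /pair_dot -dot_col_mx.
move: (HK (col_mx (embed J x - p).1 (embed J x - p).2)).
suff -> : invmx (basis_mx A B J) *m Tmx A B
    *m col_mx (embed J x - p).1 (embed J x - p).2 = x - xs by [].
rewrite -mulmxA; apply: (canLR (mulKmx Gu)).
by rewrite mulmxBr !mul_basis_mx Cxs -Cp -mulmxBr opp_col_mx add_col_mx.
Qed.

(** * Projection onto the complementary pairs *)

Lemma embed_C2 J x : (forall i, 0 <= x i 0) -> @C2 R n (embed J x).
Proof.
move=> x_ge0; split=> [i|i|]; rewrite ?mxE; try by case: ifP.
by apply: big1 => i _; rewrite !mxE; case: ifP; rewrite ?mulr0 ?mul0r.
Qed.

End CoordinateSubspace.

Lemma K1_fst_ge0 (R : realType) (a b : R) :
  K1 (a, b) -> ~ negquadrant (a, b) -> 0 <= a.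
Proof.
by rewrite /K1 /negquadrant /= => hK hN; case: (lerP 0 a) => // a_lt0;
  case: hN; split=> //; case: hK => [|[]]; lra.
Qed.

(** In the half plane [K1] and outside the open negative quadrant, the nearest
    point of the two nonnegative half axes is [(a, 0)], and it is the only one:
    this is why the diagonal belongs to [K1] only where its entries are
    nonpositive. *)
Lemma nearest_complementary_pair (R : realType) (a b x y : R) :
  K1 (a, b) -> 0 <= a -> 0 <= x -> 0 <= y -> x * y = 0 ->
  b ^+ 2 <= (x - a) ^+ 2 + (y - b) ^+ 2 ?= iff ((x == a) && (y == 0)).
Proof.
rewrite /K1 /= => hK a_ge0 x_ge0 y_ge0 /eqP; rewrite mulf_eq0.
move=> xy0; suff [h1 h2] : b ^+ 2 <= (x - a) ^+ 2 + (y - b) ^+ 2 /\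
   (b ^+ 2 = (x - a) ^+ 2 + (y - b) ^+ 2 -> x = a /\ y = 0).
  split=> //; apply/eqP/andP => [/h2[-> ->]//|[/eqP-> /eqP->]].
  by rewrite subrr sub0r sqrrN expr0n add0r.
have /orP[/eqP->|/eqP->] := xy0; last first.
  rewrite sub0r sqrrN lerDr sqr_ge0; split=> // h.
  have /eqP : (x - a) ^+ 2 = 0 by lra.
  by rewrite sqrf_eq0 subr_eq0 => /eqP.
rewrite sub0r sqrrN.
have [b_le0|b_gt0] := lerP b 0.
  have yb : y * b <= 0 by rewrite mulr_ge0_le0.
  have a2 := sqr_ge0 a; have y2 := sqr_ge0 y.
  split=> [|h]; first nra.
  have /eqP : a ^+ 2 = 0 by nra.
  have /eqP : y ^+ 2 = 0 by nra.
  by rewrite !sqrf_eq0 => /eqP -> /eqP ->.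
have ba : b < a by case: hK => [|[]]; lra.
have ya : y * b <= y * a by rewrite ler_wpM2l // ltW.
have q := sqr_ge0 (y - a).
split=> [|h]; first nra.
have y0 : y * (a - b) = 0 by nra.
have : a ^+ 2 + y ^+ 2 = 2 * (y * b) by nra.
move/eqP: y0; rewrite mulf_eq0 subr_eq0 (gt_eqF ba) orbF => /eqP->.
nra.
Qed.

Section Selection.
Context {R : realType} {n : nat} (tau : 'I_n -> 'I_2).
Implicit Types w p : 'cV[R]_n * 'cV[R]_n.

Definition first_indices : {set 'I_n} := finset (fun i => tau i == 0).

Let J := first_indices.

Lemma tau_cases i :
  i \in J /\ @Ktau R (tau i) = @K1 R \/ (i \in J) = false /\ @Ktau R (tau i) = @K2 R.
Proof. by rewrite inE /Ktau; case: ifP; [left|right]. Qed.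

Lemma K2_swap (a b : R) : K2 (a, b) -> K1 (b, a).
Proof. by rewrite /K1 /K2 /= => -[?|[-> ?]]; [left|right]. Qed.

Lemma negquadrant_swap (a b : R) : ~ negquadrant (a, b) -> ~ negquadrant (b, a).
Proof. by move=> h [? ?]; apply: h. Qed.

Lemma coords_ge0 w i : (Stau tau `&` @Omega R n) w -> 0 <= coords J w i 0.
Proof.
move=> [/(_ i) hS /(_ i) hO]; rewrite mxE.
case: (tau_cases i) hS => -[-> ->] hS; first exact: K1_fst_ge0 hS hO.
exact: K1_fst_ge0 (K2_swap hS) (negquadrant_swap hO).
Qed.

(** Both squared distances are sums over the indices, so the comparison of
    single pairs makes [embed J (coords J w)] the only minimizer. *)
Lemma metric_proj_C2 w p :
  (Stau tau `&` @Omega R n) w -> metric_proj (@C2 R n) w p ->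
  p = embed J (coords J w).
Proof.
move=> hw [[p1_ge0 p2_ge0 p12] pmin].
have prod0 i : p.1 i 0 * p.2 i 0 = 0.
  by apply: (psumr_eq0P _ p12) => // j _; rewrite mulr_ge0.
pose s := embed J (coords J w).
have Cs : @C2 R n s by apply: embed_C2 => i; exact: coords_ge0.
pose d (q : 'cV[R]_n * 'cV[R]_n) i :=
  (q.1 i 0 - w.1 i 0) ^+ 2 + (q.2 i 0 - w.2 i 0) ^+ 2.
have sum_d q : pair_dot (q - w) (q - w) = \sum_i d q i.
  by rewrite /pair_dot -big_split /=; apply: eq_bigr => i _; rewrite !mxE /d !expr2.
have nearest i : d s i <= d p i ?= iff (p.1 i 0 == s.1 i 0) && (p.2 i 0 == s.2 i 0).
  have := coords_ge0 i hw; move: hw => [/(_ i) hS _]; rewrite /d !mxE.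
  case: (tau_cases i) hS => -[-> ->] hS x_ge0.
    rewrite subrr sub0r sqrrN expr0n add0r.
    exact: nearest_complementary_pair.
  rewrite subrr sub0r sqrrN expr0n addr0 andbC addrC.
  by apply: nearest_complementary_pair => //; [exact: K2_swap | rewrite mulrC].
have le_sum := leif_sum (fun i (_ : true) => nearest i).
have eq_sum : \sum_i d s i == \sum_i d p i.
  by rewrite eq_le le_sum -!sum_d -ler_enorm pmin.
move: eq_sum; rewrite le_sum.2 => /forall_inP all_eq.
have coord i : p.1 i 0 = s.1 i 0 /\ p.2 i 0 = s.2 i 0.
  by have /andP[/eqP ? /eqP ?] := all_eq i isT.
by apply: injective_projections; apply/colP => i; case: (coord i).
Qed.

Lemma embed_Stau (x : 'cV[R]_n) : (forall i, 0 <= x i 0) -> @Stau R n tau (embed J x).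
Proof.
move=> x_ge0 i; rewrite !mxE; have := x_ge0 i; rewrite le_eqVlt => x0.
case: (tau_cases i) => -[-> ->]; rewrite /K1 /K2 /=;
  by case/predU1P: x0 => [<-|]; [right|left].
Qed.

End Selection.

(** * Sequences that stay in one selection *)

Theorem proposition3p16 (R : realType) (n : nat) (A B : 'M[R]_n)
    (c : 'cV[R]_n)
    (hAB : A - B \in unitmx)
    (hQ : nondegenerate_mx ((A^T + B^T) *m invmx (A^T - B^T)))
    (w : nat -> 'cV[R]_n * 'cV[R]_n)
    (hw : forall k : nat, projC1C2 A B c (w k) (w k.+1))
    (tau : 'I_n -> 'I_2)
    (htau : Stau tau `&` (C1 A B c `&` @C2 R n) = set0) :
  ~ exists N : nat, forall k : nat, (N <= k)%N ->
      (Stau tau `&` @Omega R n) (w k).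
Proof.
move=> [N inS]; pose J := first_indices tau.
have Gu := basis_mx_unit J hAB hQ.
pose xs := invmx (basis_mx A B J) *m (Num.sqrt 2 *: c).
have Cxs : C1 A B c (embed J xs) by rewrite /C1 /= -mul_basis_mx mulKVmx.
have [K K_ge0 step] := alternating_step Gu Cxs.
pose x m := coords J (w (N + m)%N).
pose a m := dot (x m - xs) (x m - xs).
have x_ge0 m i : 0 <= x m i 0 by apply: coords_ge0; apply: inS; rewrite leq_addr.
have a_step m : a m <= K * (a m - a m.+1).
  apply: step; rewrite addnS; have [p proj_p] := hw (N + m)%N.
  by rewrite (metric_proj_C2 (inS _ (leq_addr m N)) proj_p).
have xs_ge0 i : 0 <= xs i 0.
  rewrite leNgt; apply/negP => xs_lt0.
  have delta_le m : xs i 0 ^+ 2 <= a m.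
    apply: le_trans (sqr_coord_le_dot _ i).
    move: (x m) (xs) (x_ge0 m i) xs_lt0 => y z y_ge0 z_lt0; rewrite !mxE.
    by rewrite -sqrrN ler_sqr ?nnegrE; lra.
  have descent m : m%:R * xs i 0 ^+ 2 <= K * (a 0%N - a m).
    elim: m => [|m IH]; first by rewrite mul0r subrr mulr0.
    by have := delta_le m; have := a_step m; rewrite -natr1; lra.
  have delta_gt0 : 0 < xs i 0 ^+ 2 by rewrite exprn_even_gt0 //= lt_eqF.
  (* This bound, uniform in m, contradicts the Archimedean property. *)
  have bound m : m%:R <= K * a 0%N / xs i 0 ^+ 2.
    rewrite ler_pdivlMr //; apply: le_trans (descent m) _.
    by rewrite ler_wpM2l // gerBl dot_ge0.
  have := archi_boundP (le_trans (ler0n _ 0) (bound 0%N)).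
  by rewrite ltNge bound.
have : (Stau tau `&` (C1 A B c `&` @C2 R n)) (embed J xs).
  by split; [exact: embed_Stau | split; [|exact: embed_C2]].
by rewrite htau.
Qed.
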